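(* Let $\omega\in\mathbb{R}^d\setminus\mathbb{Q}^d$, let $K>0$ be such that $\operatorname{osc}(X)\le K$ for all Birkhoff configurations $X$ of rotation vector $\omega$, and let $\delta_0,\varepsilon_0>0$ be the continuation constants for $K$ (see context). Then there is an $0<\varepsilon_1\le\varepsilon_0$ such that for all $0<\varepsilon\le\varepsilon_1$ the following is true: when $x:\mathbb{Z}^d\to\mathbb{R}$ is a recurrent Birkhoff configuration of rotation vector $\omega$ with $V'(x_i)=0$ for all $i$, and there is an $i\in\mathbb{Z}^d$ for which $x_i$ is a local maximum of $V$, then its continuation $x(\varepsilon)$ is not Birkhoff.
   Context: Setting. Fix $d\ge 1$. A configuration is a map $x:\mathbb{Z}^d\to\mathbb{R}$; $\mathbb{R}^{\mathbb{Z}^d}$ carries the topology of pointwise convergence. Put $\|i\|=\sum_{k=1}^d|i_k|$ and $B_r(j)=\{k\in\mathbb{Z}^d : \|k-j\|\le r\}$. For $k\in\mathbb{Z}^d$, $l\in\mathbb{Z}$ let $(\tau_{k,l}x)_i=x_{i+k}+l$. $V:\mathbb{R}\to\mathbb{R}$ is a $C^2$, one-periodic Morse function ($V''\ne0$ at all critical points). The functions $S_j:\mathbb{R}^{\mathbb{Z}^d}\to\mathbb{R}$ ($j\in\mathbb{Z}^d$) satisfy: (A) there is an integer $r>0$ and for each $j$ a $C^2$ function $s_j:\mathbb{R}^{B_r(j)}\to\mathbb{R}$ with $S_j(x)=s_j(x|_{B_r(j)})$; (B) $S_j(\tau_{k,l}x)=S_{j+k}(x)$ for all $j,k\in\mathbb{Z}^d$,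 $l\in\mathbb{Z}$; (C) $\partial_{i,k}S_j\le 0$ for all $j$ and all $i\ne k$, and $\partial_{i,k}S_i<0$ whenever $\|i-k\|=1$. Put $R_i(x)=\sum_{j}\partial_iS_j(x)$. Equation $(E_\varepsilon)$ is: $V'(x_i)+\varepsilon R_i(x)=0$ for all $i\in\mathbb{Z}^d$; thus $(E_0)$ is $V'(x_i)=0$ for all $i$. Continuation. $\operatorname{osc}(x)=\sup_{\|j-i\|\le r}|x_j-x_i|$, $\|x\|_\infty=\sup_i|x_i|$, $B_\delta(x)=\{X\in\mathbb{R}^{\mathbb{Z}^d} : \|X-x\|_\infty<\delta\}$. Given $K>0$, the continuation constants are chosen as follows: let $c>0$ satisfy $|V''|>c$ at all critical points of $V$; let $C_1,C_2>0$ satisfy $|\partial_iS_j(X)|\le C_1/(2r+1)^d$ and $|\partial_{i,k}S_j(X)|\le C_2/(2r+1)^{2d}$ for all $i,j,k$ and all $X$ with $\operatorname{osc}(X)\le K+1$; fix $0<\kappa<1$; let $0<\delta_0<\frac12$ be such that $|V''(t)-V''(\sigma)|\le\kappa c/2$ whenever $\sigma$ is a critical point of $V$ and $|t-\sigma|<\delta_0$; let $\varepsilon_0=\min\{\frac{\kappa c}{2C_2},\frac{(1-\kappa)\delta_0c}{C_1}\}$. Then for every solution $x$ of $(E_0)$ with $\operatorname{osc}(x)\le K$ and every $0\le\varepsilon\le\varepsilon_0$ there is a unique solution of $(E_\varepsilon)$ in $B_{\delta_0}(x)$; it is denoted $x(\varepsilon)$ and called the continuation of $x$. Birkhoff configurations.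 For $x\ne y$ write $x<y$ if $x_i\le y_i$ for all $i$; $x,y$ are ordered if $x<y$, $x=y$ or $x>y$, and a set is ordered if any two of its elements are. $x$ is Birkhoff if $\{\tau_{k,l}x : k\in\mathbb{Z}^d,l\in\mathbb{Z}\}$ is ordered. Every Birkhoff $x$ has a rotation vector: the unique $\omega\in\mathbb{R}^d$ with $|x_i-(x_0+\omega\cdot i)|\le1$ for all $i$; hence $\operatorname{osc}(x)\le r\|\omega\|+2$. A Birkhoff configuration $x$ of rotation vector $\omega\in\mathbb{R}^d\setminus\mathbb{Q}^d$ is recurrent if there are $(k_n,l_n)\in\mathbb{Z}^d\times\mathbb{Z}$ with $\omega\cdot k_n+l_n\ne0$ and $x=\lim_n\tau_{k_n,l_n}x$ pointwise. *)

(* Defs.v *)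
From HB Require Import structures.
From mathcomp Require Import all_boot all_order all_algebra.
From mathcomp Require Import all_classical all_reals all_analysis.
Set Implicit Arguments.
Unset Strict Implicit.
Unset Printing Implicit Defensive.
Import Order.TTheory GRing.Theory Num.Theory.
Import numFieldNormedType.Exports.
Local Open Scope ring_scope.
Local Open Scope classical_set_scope.

Section PartialDerivatives.
Context {R : realType} {I : choiceType}.
Implicit Types (f : (I -> R) -> R) (x : I -> R) (i : I).

(* [dfwith x t] (at index i) is x with its i-th coordinate replaced by t. *)
Definition slice f x i : R -> R :=
  fun t => f (@dfwith I (fun=> R) x i t).

Definition partial i f x : R := derive1 (slice f x i) (x i).

(* The product topology on I -> R is the Euclidean topology when I is finite;
   class_C1 and class_C2 are only used for such I. *)
Definition class_C1 f : Prop :=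
  continuous (f : {ptws I -> R} -> R) /\
  forall i, (forall x, derivable (slice f x i) (x i) 1) /\
            continuous (partial i f : {ptws I -> R} -> R).

Definition class_C2 f : Prop := class_C1 f /\ forall i, class_C1 (partial i f).

(* For f of class class_C2 the order of differentiation is immaterial. *)
Definition partial2 i k f : (I -> R) -> R := partial i (partial k f).

End PartialDerivatives.

Definition C2_periodic_morse {R : realType} (V : R -> R) : Prop :=
  [/\ forall t, derivable V t 1,
      forall t, derivable (derive1 V) t 1,
      continuous (derive1n 2 V),
      forall t, V (t + 1) = V t
    & forall t, derive1 V t = 0 -> derive1n 2 V t != 0].

Definition local_max {R : realType} (V : R -> R) (t : R) : Prop :=
  \forall u \near t, V u <= V t.

Notation site d := 'rV[int]_d (only parsing).
Notation config R d := ('rV[int]_d -> R) (only parsing).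

Section Lattice.
Context {R : realType} {d : nat}.
Implicit Types (i j k : site d) (x y X : config R d) (S : site d -> config R d -> R).

Definition norm1 i : nat := (\sum_(m < d) `|i 0%R m|)%N.

Definition tau k (l : int) x : config R d := fun i => x (i + k) + l%:~R.

Definition finite_range (r : nat) S : Prop :=
  forall j, exists s : ({k : site d | (norm1 (k - j) <= r)%N} -> R) -> R,
    class_C2 s /\ forall x, S j x = s (fun b => x (val b)).

Definition shift_invariant S : Prop :=
  forall j k (l : int) x, S j (tau k l x) = S (j + k) x.

Definition twist S : Prop :=
  (forall j i k x, i != k -> partial2 i k (S j) x <= 0) /\
  (forall i k x, norm1 (i - k) = 1%N -> partial2 i k (S i) x < 0).

(* Finitely supported sum: under [finite_range r S] only the sites j with
   norm1 (i - j) <= r contribute. *)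
Definition force S i x : R :=
  \sum_(j \in [set: site d]) partial i (S j) x.

Definition equilibrium (V : R -> R) S (eps : R) x : Prop :=
  forall i, derive1 V (x i) + eps * force S i x = 0.

Definition osc (r : nat) x : \bar R :=
  ereal_sup [set e | exists i j, (norm1 (j - i) <= r)%N /\ e = `|x j - x i|%:E].

Definition sup_norm x : \bar R := ereal_sup [set `|x i|%:E | i in [set: site d]].

Definition sup_ball (delta : R) x : set (config R d) :=
  [set X | (sup_norm (X \- x)%R < delta%:E)%E].

Record continuation_constants (V : R -> R) S (r : nat)
    (K c C1 C2 kappa delta0 eps0 : R) : Prop := ContinuationConstants {
  cc_c_gt0 : 0 < c ;
  cc_c : forall t, derive1 V t = 0 -> c < `|derive1n 2 V t| ;
  cc_C1_gt0 : 0 < C1 ;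
  cc_C1 : forall i j X, (osc r X <= (K + 1)%:E)%E ->
    `|partial i (S j) X| <= C1 / ((2 * r + 1) ^ d)%:R ;
  cc_C2_gt0 : 0 < C2 ;
  cc_C2 : forall i j k X, (osc r X <= (K + 1)%:E)%E ->
    `|partial2 i k (S j) X| <= C2 / ((2 * r + 1) ^ (2 * d))%:R ;
  cc_kappa : 0 < kappa < 1 ;
  cc_delta0 : 0 < delta0 < 1 / 2 ;
  cc_delta0_V : forall s t, derive1 V s = 0 -> `|t - s| < delta0 ->
    `|derive1n 2 V t - derive1n 2 V s| <= kappa * c / 2 ;
  cc_eps0 : eps0 = Num.min (kappa * c / (2 * C2))
                           ((1 - kappa) * delta0 * c / C1)
}.

Definition is_continuation (V : R -> R) S (delta0 eps : R) x X : Prop :=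
  unique (fun Y => sup_ball delta0 x Y /\ equilibrium V S eps Y) X.

Definition config_lt x y : Prop := x <> y /\ forall i, x i <= y i.

Definition ordered_set (A : set (config R d)) : Prop :=
  forall x y, A x -> A y -> [\/ config_lt x y, x = y | config_lt y x].

Definition birkhoff x : Prop :=
  ordered_set [set y | exists k (l : int), y = tau k l x].

Definition dot (w : 'rV[R]_d) i : R := \sum_(m < d) w 0 m * (i 0 m)%:~R.

Definition rotation_vector x (w : 'rV[R]_d) : Prop :=
  forall i, `|x i - (x 0 + dot w i)| <= 1.

Definition irrational_vector (w : 'rV[R]_d) : Prop :=
  ~ exists q : 'rV[rat]_d, w = map_mx ratr q.

Definition recurrent x (w : 'rV[R]_d) : Prop :=
  exists (k : nat -> site d) (l : nat -> int),
    (forall n, dot w (k n) + (l n)%:~R != 0) /\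
    (forall i, (fun n => tau (k n) (l n) x i) @ \oo --> x i).

End Lattice.

(* Main.v *)
Require Import Defs.
From HB Require Import structures.
From mathcomp Require Import all_boot all_order all_algebra.
From mathcomp Require Import all_classical all_reals all_analysis.
From mathcomp Require Import zify ring lra.
Set Implicit Arguments.
Unset Strict Implicit.
Unset Printing Implicit Defensive.
Import Order.TTheory GRing.Theory Num.Theory.
Import numFieldNormedType.Exports.
Local Open Scope ring_scope.
Local Open Scope classical_set_scope.

(** The obstruction to X = x(eps) being Birkhoff is a strong maximum principle.
    Suppose X and a translate Y = tau_(k,l) X are ordered, say X <= Y; both are
    equilibria.  Off-diagonal second derivatives of the S_j are nonpositive, so
    wherever X_i = Y_i one has R_i(Y) <= R_i(X), strictly if some neighbour of i
    has X_k < Y_k.  As the equilibrium equations at such an i give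
    R_i(X) = R_i(Y), contact spreads from i to its neighbours and then to the
    whole lattice: ordered equilibria that touch somewhere coincide
    ([strong_maximum_principle]).

    Recurrence and a local maximum produce a contact.  Critical points of V are
    at least 2 * delta0 apart ([crit_sep]), so the pointwise convergence of
    translates of x to x provides a translate y = tau_(k,l) x with y_i = x_i at
    a site i where x_i is a local maximum, while w . k + l <> 0.  On the
    delta0-neighbourhood of x_i the function V' decreases at a rate of at least
    c - kappa c / 2, which beats the growth eps C2 <= kappa c / 2 of the force in
    its own coordinate; the other coordinates only lower the force.  Hence
    X_i < Y_i would make V' + eps R strictly smaller for Y than for X at i, and
    X_i = Y_i is forced ([touching_continuations]).  Then X = Y, so x = y since
    their entries are critical points less than 2 * delta0 apart; but a
    configuration with rotation vector w is fixed by tau_(k,l) only if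
    w . k + l = 0 ([tau_fixed_rotation]).

    The continuation itself is the fixed point of the quasi-Newton map
    X_i |-> X_i - (V'(X_i) + eps R_i(X)) / V''(x_i), a kappa-contraction near x
    ([newton_dist]).  No calculus of several variables enters: differences of
    partial derivatives are telescoped one coordinate at a time.  Taking
    eps1 = eps0 / 2 leaves room for the map to preserve the closed ball of
    radius delta0 / 2, whence the continuation lies in the open delta0-ball. *)

(** * One-dimensional mean values and coordinatewise increments *)

(** Stated for unordered end points, since configurations are compared
    coordinatewise without knowing which one is larger. *)
Lemma mean_value (R : realType) (f : R -> R) (a b : R) :
  (forall t, derivable f t 1) -> a != b ->
  exists2 t, (a < t < b) || (b < t < a) & f b - f a = derive1 f t * (b - a).
Proof.
move=> df; wlog ab : a b / a < b => [wl aneb|_].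
  case: (ltgtP a b) aneb => // ab _; first by apply: wl => //; rewrite lt_eqF.
  have [|t tba e] := wl b a ab; first by rewrite lt_eqF.
  by exists t; [rewrite orbC | rewrite -(opprB (f a)) e -mulrN opprB].
have [|| t tab e] := @MVT R f (derive1 f) a b ab.
- by move=> t _; rewrite derive1E; exact/derivableP.
- by apply: derivable_within_continuous => t _.
- by exists t; [move: tab; rewrite in_itv /= => -> | ].
Qed.

Lemma between_near (R : realType) (a b q s e : R) :
  `|a - s| < e -> `|b - s| < e -> (a < q < b) || (b < q < a) -> `|q - s| < e.
Proof.
rewrite !ltr_norml => /andP[? ?] /andP[? ?].
by case/orP=> /andP[? ?]; apply/andP; split; lra.
Qed.

Section Slices.
Context {R : realType} {I : choiceType}.
Implicit Types (f : (I -> R) -> R) (X Y Z : I -> R) (i k : I) (s : seq I).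

Definition slice_derivable f := forall X i, derivable (slice f X i) (X i) 1.

Definition upd X i (t : R) : I -> R := @dfwith I (fun=> R) X i t.

Lemma updE X i t k : upd X i t k = if k == i then t else X k.
Proof.
rewrite /upd; case: eqP => [->|/eqP ki]; first by rewrite dfwithin.
by rewrite dfwithout // eq_sym.
Qed.

Lemma upd_upd X i t u : upd (upd X i t) i u = upd X i u.
Proof. by apply/funext => k; rewrite !updE; case: eqP. Qed.

Lemma upd_id X i : upd X i (X i) = X.
Proof. by apply/funext => k; rewrite updE; case: eqP => [->|]. Qed.

Lemma sliceE f X i t : slice f X i t = f (upd X i t).
Proof. by []. Qed.

Lemma slice_upd f X i t : slice f (upd X i t) i = slice f X i.
Proof. by apply/funext => u; rewrite !sliceE upd_upd. Qed.

Lemma slice_increment f X i a b : slice_derivable f -> a != b ->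
  exists2 t, (a < t < b) || (b < t < a) &
    f (upd X i b) - f (upd X i a) = partial i f (upd X i t) * (b - a).
Proof.
move=> df ab; have [|t tab e] := @mean_value R (slice f X i) a b _ ab.
  by move=> t; have := df (upd X i t) i; rewrite slice_upd updE eqxx.
by exists t => //; rewrite /partial slice_upd updE eqxx.
Qed.

(** The intermediate configurations of a telescoping path from X to Y: the
    coordinates listed in s have already been switched to those of Y. *)
Definition hybrid s X Y : I -> R := fun k => if k \in s then Y k else X k.

Lemma hybrid_nil X Y : hybrid [::] X Y = X.
Proof. by []. Qed.

Lemma hybrid_cons k s X Y : hybrid (k :: s) X Y = upd (hybrid s X Y) k (Y k).
Proof.
by apply/funext => m; rewrite updE /hybrid in_cons; case: eqP => [->|].
Qed.

(** Each of the [size s] switches costs at most M * D by the one-dimensional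
    mean value theorem; the hypothesis on M is needed only on configurations
    lying coordinatewise between X and Y, since the path stays there. *)
Lemma hybrid_dist f X Y s (M D : R) : slice_derivable f -> 0 <= D ->
  (forall Z, (forall k, (X k <= Z k <= Y k) || (Y k <= Z k <= X k)) ->
     forall k, `|partial k f Z| <= M) ->
  (forall k, `|Y k - X k| <= D) ->
  `|f (hybrid s X Y) - f X| <= M * D *+ size s.
Proof.
move=> df D0 fM XYD.
have btwXY k : (X k <= X k <= Y k) || (Y k <= X k <= X k).
  by rewrite lexx andbT /=; case: (leP (X k) (Y k)) => // /ltW.
have btwYX k : (X k <= Y k <= Y k) || (Y k <= Y k <= X k).
  by rewrite lexx andbT /=; case: (leP (X k) (Y k)) => // /ltW.
elim: s => [|k s ih]; first by rewrite hybrid_nil subrr normr0.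
rewrite hybrid_cons mulrS.
apply: le_trans (ler_distD (f (hybrid s X Y)) _ _) _; apply: lerD ih.
set H := hybrid s X Y.
have M0 : 0 <= M by apply: le_trans (fM X btwXY k); rewrite normr_ge0.
have [HY|HY] := eqVneq (H k) (Y k).
  by rewrite -HY upd_id subrr normr0 mulr_ge0.
have HX : H k = X k by move: HY; rewrite /H /hybrid; case: ifP => //; rewrite eqxx.
have [t tXY e] := slice_increment H k df HY.
have -> : f H = f (upd H k (H k)) by rewrite upd_id.
rewrite e normrM HX; apply: ler_pM => //; apply: fM => m; rewrite updE.
case: eqP => [->|_]; last by rewrite /H /hybrid; case: ifP.
by move: tXY; rewrite HX => /orP[]/andP[/ltW-> /ltW->]; rewrite ?orbT.
Qed.

Lemma hybrid_le f X Y s : slice_derivable f -> (forall k, X k <= Y k) ->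
  (forall k Z, X k != Y k -> partial k f Z <= 0) ->
  f (hybrid s X Y) <= f X.
Proof.
move=> df XY f0; elim: s => [|k s ih]; first by rewrite hybrid_nil.
apply: le_trans ih; rewrite hybrid_cons; set H := hybrid s X Y.
have [HY|HY] := eqVneq (H k) (Y k); first by rewrite -HY upd_id.
have HX : H k = X k by move: HY; rewrite /H /hybrid; case: ifP => //; rewrite eqxx.
have [t _ e] := slice_increment H k df HY.
have -> : f H = f (upd H k (H k)) by rewrite upd_id.
by rewrite -subr_le0 e HX mulr_le0_ge0 ?subr_ge0 // f0 // -HX.
Qed.

Definition supported s f := forall X Y, {in s, X =1 Y} -> f X = f Y.

Lemma supported_hybrid s f X Y : supported s f -> f (hybrid s X Y) = f Y.
Proof. by apply=> k ks; rewrite /hybrid ks. Qed.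

(** Switching k first gives the strict decrease; the remaining switches can
    only decrease f further. *)
Lemma supported_lt s f X Y k : supported s f -> slice_derivable f ->
  (forall m, X m <= Y m) -> (forall m Z, X m != Y m -> partial m f Z <= 0) ->
  X k < Y k -> (forall Z, partial k f Z < 0) -> f Y < f X.
Proof.
move=> sf df XY f0 XYk fk; set X' := upd X k (Y k).
have XkYk : X k != Y k by rewrite lt_eqF.
apply: (@le_lt_trans _ _ (f X')).
  rewrite -(supported_hybrid X' Y sf); apply: hybrid_le => // m; rewrite /X' updE.
    by case: eqP => [->|].
  by case: (eqVneq m k) => [->|_ Z]; [rewrite eqxx | exact: f0].
have [t _ e] := slice_increment X k df XkYk.
rewrite -subr_lt0; have -> : f X = f (upd X k (X k)) by rewrite upd_id.
by rewrite e nmulr_rlt0 // subr_gt0.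
Qed.

End Slices.

(** * Functions of finitely many coordinates *)

Section Cylinder.
Context {R : realType} {I : choiceType} (p : pred I).
Implicit Types (g : (I -> R) -> R) (h : ({k : I | p k} -> R) -> R).

Lemma slice_cylinder_in g h X i (pi : p i) :
  (forall Z, g Z = h (fun b => Z (val b))) ->
  slice g X i = slice h (fun b => X (val b)) (exist _ i pi).
Proof.
move=> gh; apply/funext => t; rewrite !sliceE gh; congr h.
by apply/funext => b; rewrite !updE -val_eqE.
Qed.

Lemma slice_cylinder_out g h X i : ~~ p i ->
  (forall Z, g Z = h (fun b => Z (val b))) -> slice g X i = cst (g X).
Proof.
move=> npi gh; apply/funext => t; rewrite sliceE /= !gh; congr h.
apply/funext => b; rewrite updE; case: eqP => // bi.
by move: (valP b) npi; rewrite bi => ->.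
Qed.

Lemma cylinder_derivable g h : slice_derivable h ->
  (forall Z, g Z = h (fun b => Z (val b))) -> slice_derivable g.
Proof.
move=> dh gh X i; case: (boolP (p i)) => [pi|npi].
  by rewrite (slice_cylinder_in _ pi gh); exact: (dh (fun b => X (val b)) (exist _ i pi)).
by rewrite (slice_cylinder_out X npi gh); exact: derivable_cst.
Qed.

Lemma partial_cylinder_out g h X i : ~~ p i ->
  (forall Z, g Z = h (fun b => Z (val b))) -> partial i g X = 0.
Proof. by move=> npi gh; rewrite /partial (slice_cylinder_out X npi gh) derive1_cst. Qed.

(** Partial derivatives of a cylinder function are again cylinder functions over
    the same sites, which gives them slices that are differentiable and makes
    them depend on finitely many coordinates. *)
Lemma partial_cylinder g h i : class_C2 h ->
  (forall Z, g Z = h (fun b => Z (val b))) ->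
  exists2 h' : ({k : I | p k} -> R) -> R, slice_derivable h' &
    forall Z, partial i g Z = h' (fun b => Z (val b)).
Proof.
move=> [_ C2h] gh; case: (boolP (p i)) => [pi|npi]; last first.
  exists (fun=> 0) => [X k|Z]; last exact: partial_cylinder_out npi gh.
  exact: derivable_cst.
exists (partial (exist _ i pi) h) => [X k|Z].
  by have [_ /(_ k)[]] := C2h (exist _ i pi).
by rewrite /partial (slice_cylinder_in Z pi gh).
Qed.

End Cylinder.

(** * The force as a sum over a box *)

Section Box.
Context {d : nat} (r : nat).
Implicit Types (i j k : 'rV[int]_d) (t : 'rV['I_(2 * r + 1)]_d).

(** The sup-norm box of radius r about i, which contains the l1-ball of radius r
    and has exactly (2r+1)^d sites: the number by which the bounds on the first
    and second derivatives of the S_j are normalized. *)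
Definition box i t : 'rV[int]_d := \row_m (i 0 m + (t 0 m : nat)%:Z - r%:Z).

Lemma box_inj i : injective (box i).
Proof.
move=> t u /rowP tu; apply/rowP => m; apply/val_inj => /=.
by move: (tu m); rewrite !mxE; lia.
Qed.

Lemma box_addr i k t : box i t + k = box (i + k) t.
Proof. by apply/rowP => m; rewrite !mxE addrAC (addrAC (i 0 m)). Qed.

Lemma norm1N i : norm1 (- i) = norm1 i.
Proof. by apply: eq_bigr => m _; rewrite !mxE abszN. Qed.

Lemma norm1B i j : norm1 (i - j) = norm1 (j - i).
Proof. by rewrite -norm1N opprB. Qed.

Lemma le_norm1 i m : (`|i 0%R m| <= norm1 i)%N.
Proof. by rewrite /norm1 (bigD1 m) //= leq_addr. Qed.

Lemma ball_box i j : (norm1 (j - i) <= r)%N -> exists t, j = box i t.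
Proof.
move=> jir.
have le_r m : (`|(j 0 m - i 0 m)%R| <= r)%N.
  by have := leq_trans (le_norm1 _ m) jir; rewrite !mxE.
have H m : (`|(j 0 m - i 0 m + r%:Z)%R| < 2 * r + 1)%N by have := le_r m; lia.
exists (\row_m Ordinal (H m)); apply/rowP => m; rewrite !mxE /=.
by have := le_r m; lia.
Qed.

Definition box_sites i : seq 'rV[int]_d :=
  [seq box i t | t <- enum 'rV['I_(2 * r + 1)]_d].

Lemma size_box_sites i : size (box_sites i) = ((2 * r + 1) ^ d)%N.
Proof. by rewrite size_map -cardE card_mx card_ord mul1n. Qed.

Lemma mem_box_sites i j : (norm1 (j - i) <= r)%N -> j \in box_sites i.
Proof. by case/ball_box => t ->; rewrite map_f // mem_enum. Qed.

End Box.

Section Force.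
Context {R : realType} {d : nat} (r : nat).
Variable S : 'rV[int]_d -> ('rV[int]_d -> R) -> R.
Hypothesis frS : finite_range r S.
Implicit Types (i j k : 'rV[int]_d) (X Y : 'rV[int]_d -> R).

Lemma partial_far i j X : (r < norm1 (i - j))%N -> partial i (S j) X = 0.
Proof.
have [s [_ Ss]] := frS j => ijr.
by apply: partial_cylinder_out Ss; rewrite -ltnNge.
Qed.

Lemma partial_slice_derivable i j : slice_derivable (partial i (S j)).
Proof.
have [s [C2s Ss]] := frS j.
have [s' ds' Ss'] := partial_cylinder i C2s Ss.
exact: cylinder_derivable ds' Ss'.
Qed.

Lemma partial_supported i j : supported (box_sites r j) (partial i (S j)).
Proof.
have [s [C2s Ss]] := frS j.
have [s' ds' Ss'] := partial_cylinder i C2s Ss.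
move=> X Y XY; rewrite !Ss'; congr s'; apply/funext => b.
by apply: XY; apply: mem_box_sites; exact: (valP b).
Qed.

Lemma force_box i X :
  force S i X = \sum_(t : 'rV['I_(2 * r + 1)]_d) partial i (S (box i t)) X.
Proof.
transitivity (\sum_(j \in range (box (r := r) i)) partial i (S j) X).
  apply/esym/fsbig_widen => // j /= [_ nj]; apply: partial_far; rewrite ltnNge.
  by apply/negP; rewrite norm1B => /ball_box[t jE]; apply: nj; exists t.
rewrite fsbig_image; last by move=> t u _ _ /box_inj.
rewrite (@fsbigE _ _ _ _ _ (enum 'rV['I_(2 * r + 1)]_d)) ?enum_uniq //.
  by rewrite big_enum_cond /=; apply: eq_bigl => t; rewrite in_setT.
by move=> t _; rewrite mem_enum.
Qed.

Lemma force_bound i X (C1 : R) :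
  (forall j, `|partial i (S j) X| <= C1 / ((2 * r + 1) ^ d)%:R) ->
  `|force S i X| <= C1.
Proof.
move=> H; rewrite force_box; apply: le_trans (ler_norm_sum _ _ _) _.
apply: le_trans (ler_sum _ (fun t _ => H (box i t))) _.
by rewrite sumr_const card_mx card_ord mul1n -[_ *+ _]mulr_natr mulfVK // addn1.
Qed.

(** There are (2r+1)^d energies S_j and (2r+1)^d coordinates for each of them,
    so the normalization of C2 makes the total Lipschitz constant C2. *)
Lemma force_dist i X Y (C2 D : R) : 0 <= D ->
  (forall Z, (forall k, (X k <= Z k <= Y k) || (Y k <= Z k <= X k)) ->
    forall j k, `|partial2 k i (S j) Z| <= C2 / ((2 * r + 1) ^ (2 * d))%:R) ->
  (forall k, `|Y k - X k| <= D) ->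
  `|force S i Y - force S i X| <= C2 * D.
Proof.
move=> D0 H XYD; rewrite !force_box -sumrB.
apply: le_trans (ler_norm_sum _ _ _) _.
pose B := C2 / ((2 * r + 1) ^ (2 * d))%:R * D *+ ((2 * r + 1) ^ d).
apply: (@le_trans _ _ (\sum_(t : 'rV['I_(2 * r + 1)]_d) B)).
  apply: ler_sum => t _; rewrite -(supported_hybrid X Y (@partial_supported i _)).
  rewrite /B -(size_box_sites r (box i t)).
  apply: hybrid_dist => // [|Z XYZ k]; first exact: partial_slice_derivable.
  exact: H.
rewrite sumr_const card_mx card_ord mul1n /B -mulrnA -expnD addnn -mul2n.
by rewrite -[_ *+ _]mulr_natr mulrAC mulfVK // addn1.
Qed.

Lemma partial_le i j X Y : twist S -> (forall k, X k <= Y k) -> X i = Y i ->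
  partial i (S j) Y <= partial i (S j) X.
Proof.
move=> [tw _] XY XYi; rewrite -(supported_hybrid X Y (@partial_supported i j)).
apply: hybrid_le => //; first exact: partial_slice_derivable.
by move=> k Z XYk; apply: tw; apply: contra XYk => /eqP ->; rewrite XYi.
Qed.

Lemma force_le i X Y : twist S -> (forall k, X k <= Y k) -> X i = Y i ->
  force S i Y <= force S i X.
Proof. by move=> tw XY XYi; rewrite !force_box ler_sum // => t _; exact: partial_le. Qed.

(** The strict decrease comes from the summand S_k: it is the mixed derivative in
    the directions k and i of S_k itself that the twist condition makes negative. *)
Lemma force_lt i k X Y : twist S -> (0 < r)%N -> (forall m, X m <= Y m) ->
  X i = Y i -> norm1 (k - i) = 1%N -> X k < Y k ->
  force S i Y < force S i X.
Proof.
move=> tw r0 XY XYi ki XYk.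
have [t kt] : exists t, k = box (r := r) i t by apply: ball_box; rewrite ki.
rewrite !force_box (bigD1 t) //= [ltRHS](bigD1 t) //=.
apply: ltr_leD; last by apply: ler_sum => u _; exact: partial_le.
rewrite -kt; have [tw0 tw1] := tw.
apply: (@supported_lt _ _ (box_sites r k) _ X Y k) => //.
- exact: partial_supported.
- exact: partial_slice_derivable.
- by move=> m Z XYm; apply: tw0; apply: contra XYm => /eqP ->; rewrite XYi.
- by move=> Z; exact: tw1.
Qed.

(** Shifting the configuration by k shifts all sites by k, and the integer l only
    translates the variable of each slice. *)
Lemma force_tau i k l X : shift_invariant S ->
  force S i (tau k l X) = force S (i + k) X.
Proof.
move=> siS; rewrite !force_box; apply: eq_bigr => t _; rewrite -box_addr.
rewrite /partial; set f := slice _ _ _; set g := slice _ _ _.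
have fg a : f a = g (a - l%:~R).
  rewrite /f /g !sliceE -(siS _ _ l); congr (S _ _); apply/funext => j.
  by rewrite /tau !updE (inj_eq (addIr k)); case: eqP => // _; rewrite subrK.
rewrite /derive1.
have -> // : (fun h => h^-1 *: (f (h + tau k l X i) - f (tau k l X i))) =
          (fun h => h^-1 *: (g (h + X (i + k)) - g (X (i + k)))).
by apply/funext => h; rewrite !fg /tau !addrA !addrK.
Qed.

End Force.

(** * A fixed point theorem for the supremum distance *)

Lemma le_geometric_eq0 (R : realType) (q a D : R) : 0 <= q < 1 ->
  (forall n, `|a| <= q ^+ n * D) -> a = 0.
Proof.
move=> /andP[q0 q1] aD; apply/eqP; rewrite -normr_le0 leNgt; apply/negP => a0.
have q1' : `|q| < 1 by rewrite ger0_norm.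
have [N _ /(_ N (leqnn N)) /=] := cvgr_lt 0 (cvg_geometric D q1') _ a0.
by apply/negP; rewrite -leNgt mulrC.
Qed.

Lemma cvg_dist_le (R : realType) (u : nat -> R) (l a B : R) N :
  u @ \oo --> l -> (forall n, (N <= n)%N -> `|u n - a| <= B) -> `|l - a| <= B.
Proof.
move=> ul uB; apply/ler_addgt0Pr => e e0.
move/cvgrPdist_lt : ul => /(_ e e0)[M _ HM].
have := HM (maxn M N) (leq_maxl _ _) => /= lu.
rewrite [leRHS]addrC; apply: le_trans (ler_distD (u (maxn M N)) _ _) _.
by rewrite lerD ?uB ?leq_maxr // ltW.
Qed.

(** The supremum distance between functions on I may be infinite, so the
    contraction property is phrased through uniform bounds D and the iterates
    converge pointwise.  Comparing T^n(T^m x) with T^n x directly bounds the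
    tail by q^n times the diameter 2 * rho. *)
Lemma contraction_fixed_point (R : realType) (I : Type) (x : I -> R) (q rho : R)
    (T : (I -> R) -> (I -> R)) : 0 <= q < 1 -> 0 <= rho ->
  (forall X, (forall i, `|X i - x i| <= rho) -> forall i, `|T X i - x i| <= rho) ->
  (forall X Y D, (forall i, `|X i - x i| <= rho) -> (forall i, `|Y i - x i| <= rho) ->
     (forall i, `|X i - Y i| <= D) -> forall i, `|T X i - T Y i| <= q * D) ->
  exists2 X, forall i, `|X i - x i| <= rho & forall i, T X i = X i.
Proof.
move=> q01 rho0 Tball Tcontr; have /andP[q0 q1] := q01.
pose u n := iter n T x.
have uball n i : `|u n i - x i| <= rho.
  by elim: n i => [|n ih] i; [rewrite subrr normr0 | exact: Tball].
have ucontr n m i : `|u (n + m)%N i - u n i| <= q ^+ n * (2 * rho).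
  elim: n i => [|n ih] i.
    by rewrite expr0 mul1r; have := uball m i; rewrite add0n; lra.
  rewrite addSn exprS -mulrA; apply: Tcontr => //; exact: uball.
have uN N n i : (N <= n)%N -> `|u n i - u N i| <= q ^+ N * (2 * rho).
  by move=> Nn; rewrite -(subnKC Nn).
have ucvg i : cvg ((fun n => u n i) @ \oo).
  apply/cauchy_cvgP/cauchy_exP => e e0.
  have q1' : `|q| < 1 by rewrite ger0_norm.
  have [N _ /(_ N (leqnn N)) /=] := cvgr_lt 0 (cvg_geometric (2 * rho) q1') _ e0.
  rewrite mulrC => qN; exists (u N i); exists N => // n /= Nn.
  by rewrite /ball /= distrC; apply: le_lt_trans qN; exact: uN.
pose L i := limn (fun n => u n i).
have Lball i : `|L i - x i| <= rho.
  by apply: (cvg_dist_le (N := 0) (ucvg i)) => n _; exact: uball.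
have uL n i : `|L i - u n i| <= q ^+ n * (2 * rho).
  by apply: (cvg_dist_le (ucvg i)) => m; exact: uN.
exists L => // i; apply/eqP; rewrite -subr_eq0; apply/eqP.
apply: (le_geometric_eq0 (D := 4 * rho) q01) => n.
have h1 := Tcontr L (u n) _ Lball (uball n) (uL n) i.
have h2 := uL n.+1 i.
have h3 : q ^+ n.+1 * (2 * rho) <= q ^+ n * (2 * rho).
  by rewrite ler_wpM2r ?mulr_ge0 // exprS ler_piMl ?exprn_ge0 // ltW.
rewrite mulrA -exprS in h1.
rewrite (_ : 4 * rho = 2 * rho + 2 * rho); last by lra.
rewrite mulrDr.
apply: le_trans (ler_distD (u n.+1 i) _ _) _.
rewrite [`|u _ _ - _|]distrC.
by apply: lerD; [apply: le_trans h1 _ | apply: le_trans h2 _].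
Qed.

(** * Oscillation, rotation vectors and connectedness of the lattice *)

Section Configurations.
Context {R : realType} {d : nat}.
Implicit Types (i j k : 'rV[int]_d) (x X Y : 'rV[int]_d -> R) (r : nat).

Lemma osc_leP r X (M : R) : (osc r X <= M%:E)%E <->
  forall i j, (norm1 (j - i) <= r)%N -> `|X j - X i| <= M.
Proof.
split=> [oM i j ij|H].
  rewrite -lee_fin; apply: le_trans oM; apply: ereal_sup_ubound.
  by exists i, j.
by apply: ge_ereal_sup => _ [i [j [ij ->]]]; rewrite lee_fin; exact: H.
Qed.

Lemma sup_ball_lt (delta : R) x X : sup_ball delta x X ->
  forall i, `|X i - x i| < delta.
Proof.
move=> xX i; rewrite -lte_fin; apply: le_lt_trans xX; apply: ereal_sup_ubound.
by exists i.
Qed.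

Lemma le_sup_ball (rho delta : R) x X : rho < delta ->
  (forall i, `|X i - x i| <= rho) -> sup_ball delta x X.
Proof.
move=> rd H; rewrite /sup_ball /=; apply: (@le_lt_trans _ _ rho%:E).
  by apply: ge_ereal_sup => _ [i _ <-]; rewrite lee_fin; exact: H.
by rewrite lte_fin.
Qed.

Lemma osc_tau r k l X : osc r (tau k l X) = osc r X.
Proof.
congr ereal_sup; apply/seteqP; split => e /= [i [j [ij ->]]].
  exists (i + k), (j + k); split; first by rewrite opprD addrACA subrr addr0.
  by rewrite /tau opprD addrACA subrr addr0.
exists (i - k), (j - k); split; first by rewrite opprB addrA subrK.
by rewrite /tau !subrK opprD addrACA subrr addr0.
Qed.

Lemma osc_near r X x (K e : R) : (osc r x <= K%:E)%E ->
  (forall i, `|X i - x i| <= e) -> (osc r X <= (K + 2 * e)%:E)%E.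
Proof.
move=> /osc_leP xK Xx; apply/osc_leP => i j ij.
have := xK i j ij; have := Xx i; have := Xx j; rewrite !ler_norml; lra.
Qed.

Lemma dot_mulrn (w : 'rV[R]_d) k n : dot w (k *+ n) = dot w k *+ n.
Proof.
rewrite /dot -sumrMnl; apply: eq_bigr => m _.
by rewrite mulmxnE rmorphMn mulrnAr.
Qed.

(** Iterating the relation x_(j+k) + l = x_j along multiples of k makes the
    deviation of x_(nk) from linear growth equal to n |w . k + l|, which must
    stay at most 1. *)
Lemma tau_fixed_rotation x (w : 'rV[R]_d) k l : rotation_vector x w ->
  tau k l x = x -> dot w k + l%:~R = 0.
Proof.
move=> rx txx; set a := _ + _.
have xk n : x (k *+ n) = x 0 - l%:~R *+ n.
  elim: n => [|n ih]; first by rewrite !mulr0n subr0.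
  have := congr1 (fun f => f (k *+ n)) txx; rewrite /tau -mulrSr ih => E.
  by rewrite [_%:~R *+ _]mulrSr opprD addrA -E addrK.
have an n : `|a| *+ n <= 1.
  have := rx (k *+ n); rewrite xk dot_mulrn opprD addrACA subrr add0r -opprD.
  by rewrite normrN addrC -mulrnDl normrMn.
apply/eqP; rewrite -normr_eq0; apply/negP => /negP a0.
have a_gt0 : 0 < `|a| by rewrite lt_neqAle eq_sym a0 normr_ge0.
have := an (Num.bound `|a|^-1); rewrite leNgt => /negP; apply.
have := archi_boundP (ltW (_ : 0 < `|a|^-1)); rewrite invr_gt0 => /(_ a_gt0).
by move=> bn; rewrite -(mulfV a0) -[_ *+ _]mulr_natr ltr_pM2l.
Qed.

Lemma lattice_connected (P : 'rV[int]_d -> Prop) i :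
  (forall j k, norm1 (k - j) = 1%N -> P j -> P k) -> P i -> forall k, P k.
Proof.
move=> step Pi k; have [n] := ubnP (norm1 (k - i)); elim: n k => // n ih k kn.
have [->//|ki] := eqVneq k i.
have [m km] : exists m, (k - i) 0 m != 0.
  apply/existsP; rewrite -negb_forall; apply: contra ki => /forallP H.
  by rewrite -subr_eq0; apply/eqP/rowP => m; rewrite (eqP (H m)) mxE.
(* One unit step from k towards i along the coordinate m. *)
pose e : 'rV[int]_d := \row_m' (if m' == m then Num.sg ((k - i) 0 m) else 0).
have ke : norm1 (k - (k - e)) = 1%N.
  rewrite opprB addrC subrK /norm1 (bigD1 m) //= big1 => [|m' /negbTE mm'].
    by rewrite mxE eqxx addn0; move: km; case: sgrP.
  by rewrite mxE mm'.
apply: (step (k - e)) => //; apply: ih.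
rewrite ltnS in kn; apply: leq_trans kn; rewrite /norm1 (bigD1 m) //= [ltnRHS](bigD1 m) //=.
rewrite -addSn; apply: leq_add; last first.
  by apply: leq_sum => m' /negbTE mm'; rewrite !mxE mm' subr0.
move: km; rewrite !mxE eqxx; set a := k 0 m; set b := i 0 m.
by case: sgrP; lia.
Qed.

End Configurations.

(** * The potential near its critical points *)

Section Potential.
Context {R : realType} (V : R -> R).
Hypothesis morseV : C2_periodic_morse V.

Lemma derivable_derive1_potential t : derivable (derive1 V) t 1.
Proof. by case: morseV. Qed.

Lemma derive1_potential_addz (l : int) t : derive1 V (t + l%:~R) = derive1 V t.
Proof.
have [_ _ _ per _] := morseV.
have pern (n : nat) u : V (u + n%:R) = V u.
  by elim: n => [|n ih]; rewrite ?addr0 // mulrSr addrA per.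
have perz u : V (u + l%:~R) = V u.
  case: l => n; first exact: pern.
  by rewrite NegzE mulrNz -[in RHS](subrK (n.+1%:R) u) pern.
rewrite /derive1.
have -> // : (fun h => h^-1 *: (V (h + (t + l%:~R)) - V (t + l%:~R))) =
          (fun h => h^-1 *: (V (h + t) - V t)).
by apply/funext => h; rewrite addrA !perz.
Qed.

Context (c kappa delta0 : R).
Hypothesis c_gt0 : 0 < c.
Hypothesis V2_crit : forall t, derive1 V t = 0 -> c < `|derive1n 2 V t|.
Hypothesis kappa01 : 0 < kappa < 1.
Hypothesis delta0_gt0 : 0 < delta0.
Hypothesis V2_near : forall s t, derive1 V s = 0 -> `|t - s| < delta0 ->
  `|derive1n 2 V t - derive1n 2 V s| <= kappa * c / 2.

Let kc_lt : kappa * c < c.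
Proof. by rewrite gtr_pMl //; case/andP: kappa01. Qed.

(** Otherwise V'' would vanish between s and t, at a point within delta0 of one
    of them, where |V''| is at least c - kappa c / 2. *)
Lemma crit_sep s t : derive1 V s = 0 -> derive1 V t = 0 ->
  `|t - s| < 2 * delta0 -> s = t.
Proof.
have d0 := delta0_gt0.
move=> s0 t0 st; apply/eqP; apply/negP => /negP sNt.
have [q qst] := mean_value derivable_derive1_potential sNt.
rewrite s0 t0 subrr => /esym/eqP; rewrite mulf_eq0 subr_eq0 [t == s]eq_sym (negbTE sNt) orbF.
move=> /eqP q0.
have : `|q - s| < delta0 \/ `|q - t| < delta0.
  case: (ltP `|q - s| delta0) => qs; [by left | right].
  move: st qs; rewrite !ltr_norml ler_normr.
  by case/orP: qst => /andP[? ?] /andP[? ?] /orP[]?; apply/andP; split; lra.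
suff crit_far u : derive1 V u = 0 -> delta0 <= `|q - u|.
  by case; apply/negP; rewrite -leNgt crit_far.
move=> u0; rewrite leNgt; apply/negP => /(V2_near u0) /=.
rewrite q0 sub0r normrN; apply/negP; rewrite -ltNge.
by apply: lt_trans _ (V2_crit u0); move: c_gt0 kc_lt; lra.
Qed.

(** If V'' were positive at s, then V' and hence V would increase just to the
    right of s; so V'' < - c at s, and it varies by at most kappa c / 2. *)
Lemma local_max_concave s t : derive1 V s = 0 -> local_max V s ->
  `|t - s| < delta0 -> derive1n 2 V t <= - (c - kappa * c / 2).
Proof.
have [d0 [c0 kc]] := conj delta0_gt0 (conj c_gt0 kc_lt).
have neg (a b : R) : c < - b -> `|a - b| <= kappa * c / 2 -> a <= - (c - kappa * c / 2).
  by move=> ? /ler_normlW; lra.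
have pos (a b : R) : c < b -> `|a - b| <= kappa * c / 2 -> 0 < a.
  by move=> ?; rewrite distrC => /ler_normlW; lra.
move=> s0 [e /= e0 maxs] st.
have := V2_crit s0; rewrite ltr_normr => /orP[V2s|V2s]; last first.
  exact: neg V2s (V2_near s0 st).
pose u := s + Num.min (e / 2) (delta0 / 2).
have m0 : 0 < Num.min (e / 2) (delta0 / 2) by rewrite lt_min !divr_gt0.
have us : s < u by rewrite ltrDl.
have ue : u - s <= e / 2 by rewrite addrC addKr ge_min lexx.
have ud : u - s <= delta0 / 2 by rewrite addrC addKr ge_min lexx orbT.
have Vu : V u <= V s.
  by apply: maxs; rewrite /= distrC gtr0_norm ?subr_gt0 //; lra.
have dV v : derivable V v 1 by case: morseV.
have su : s != u by rewrite lt_eqF.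
have [p psu pE] := mean_value dV su.
have [sp pu] : s < p /\ p < u by case/orP: psu => /andP[]; lra.
have sNp : s != p by rewrite lt_eqF.
have [q qsp qE] := mean_value derivable_derive1_potential sNp.
have [sq qp] : s < q /\ q < p by case/orP: qsp => /andP[]; lra.
have V2q : 0 < derive1 (derive1 V) q.
  have /(V2_near s0) : `|q - s| < delta0 by rewrite gtr0_norm ?subr_gt0 //; lra.
  exact: pos V2s.
have V1p : 0 < derive1 V p by rewrite s0 subr0 in qE; rewrite qE mulr_gt0 ?subr_gt0.
have : 0 < V u - V s by rewrite pE mulr_gt0 ?subr_gt0.
by rewrite subr_gt0 ltNge Vu.
Qed.

End Potential.

(** * The strong maximum principle *)

(** Contact of X and Y at one site passes to its neighbours, because a neighbour
    without contact would make the forces at that site differ. *)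
Lemma strong_maximum_principle (R : realType) (d : nat) (V : R -> R)
    (S : 'rV[int]_d -> ('rV[int]_d -> R) -> R) (r : nat) (eps : R)
    (X Y : 'rV[int]_d -> R) i :
  finite_range r S -> (0 < r)%N -> twist S -> 0 < eps ->
  equilibrium V S eps X -> equilibrium V S eps Y ->
  (forall k, X k <= Y k) -> X i = Y i -> X = Y.
Proof.
move=> frS r0 tw eps0 eX eY XY XYi; apply/funext.
apply: (lattice_connected _ XYi) => j k kj XYj; apply/eqP; apply/negP => /negP XYk.
have XYk' : X k < Y k by rewrite lt_neqAle XYk XY.
have := force_lt frS tw r0 XY XYj kj XYk'.
have := eX j; have := eY j; rewrite XYj => <- /addrI.
by move=> /(mulfI (lt0r_neq0 eps0)) ->; rewrite ltxx.
Qed.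

(** * Continuation of solutions *)

Section Continuation.
Context {R : realType} {d : nat} (V : R -> R).
Context (S : 'rV[int]_d -> ('rV[int]_d -> R) -> R) (r : nat).
Context (K c C1 C2 kappa delta0 eps0 : R).
Hypothesis morseV : C2_periodic_morse V.
Hypothesis frS : finite_range r S.
Hypothesis cc : continuation_constants V S r K c C1 C2 kappa delta0 eps0.
Implicit Types (i j k : 'rV[int]_d) (x X Y Z : 'rV[int]_d -> R).

Let c_gt0 := cc_c_gt0 cc.
Let C1_gt0 := cc_C1_gt0 cc.
Let C2_gt0 := cc_C2_gt0 cc.

Let kappa01 : 0 < kappa < 1 := cc_kappa cc.

Let kappa_lt1 : kappa < 1.
Proof. by case/andP: kappa01. Qed.

Let kappa_gt0 : 0 < kappa.
Proof. by case/andP: kappa01. Qed.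

Let delta0_gt0 : 0 < delta0.
Proof. by case/andP: (cc_delta0 cc). Qed.

Let delta0_lt : delta0 < 1 / 2.
Proof. by case/andP: (cc_delta0 cc). Qed.

Let signs : [/\ 0 < c, 0 < delta0, delta0 < 1 / 2, 0 < kappa & kappa < 1].
Proof. by []. Qed.

Lemma eps0_gt0 : 0 < eps0.
Proof. by rewrite (cc_eps0 cc) lt_min !divr_gt0 ?mulr_gt0 ?subr_gt0. Qed.

Lemma eps_C2 eps : eps <= eps0 -> eps * C2 <= kappa * c / 2.
Proof.
have [c0 d0 d1 k0 k1] := signs.
rewrite (cc_eps0 cc) le_min => /andP[+ _].
by rewrite ler_pdivlMr ?mulr_gt0 //; lra.
Qed.

Lemma eps_C1 eps : eps <= eps0 / 2 -> eps * C1 <= c * ((1 - kappa) * delta0 / 2).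
Proof.
have [c0 d0 d1 k0 k1] := signs.
move=> e; have : eps * 2 <= eps0 by lra.
rewrite (cc_eps0 cc) le_min => /andP[_].
by rewrite ler_pdivlMr //; lra.
Qed.

(** X, Y and everything between them stay within delta0 < 1/2 of x, so their
    oscillation is at most K + 1, where the bound C2 is available. *)
Lemma force_near_dist x i X Y D : (osc r x <= K%:E)%E ->
  (forall k, `|X k - x k| < delta0) -> (forall k, `|Y k - x k| < delta0) ->
  0 <= D -> (forall k, `|Y k - X k| <= D) ->
  `|force S i Y - force S i X| <= C2 * D.
Proof.
have [c0 d0 d1 k0 k1] := signs.
move=> xK Xx Yx D0 XYD; apply: force_dist => // Z XYZ j k; apply: (cc_C2 cc).
have Zx m : `|Z m - x m| <= delta0.
  have := XYZ m; have := Xx m; have := Yx m; rewrite !ltr_norml ler_norml.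
  by move=> /andP[? ?] /andP[? ?] /orP[]/andP[? ?]; apply/andP; split; lra.
by apply: le_trans (osc_near xK Zx) _; rewrite lee_fin lerD2l; lra.
Qed.

(** Newton's iteration for the equilibrium equation, with the derivative frozen
    at the diagonal matrix V''(x_i) of the unperturbed problem. *)
Definition newton eps x X : 'rV[int]_d -> R :=
  fun i => X i - (derive1 V (X i) + eps * force S i X) / derive1n 2 V (x i).

(** The variation of V'' and the force each contribute kappa c / 2 to the
    numerator of the Lipschitz constant, and the denominator |V''(x_i)| exceeds c. *)
Lemma newton_dist eps x X Y D : 0 <= eps <= eps0 ->
  (osc r x <= K%:E)%E -> (forall i, derive1 V (x i) = 0) ->
  (forall i, `|X i - x i| < delta0) -> (forall i, `|Y i - x i| < delta0) ->
  (forall i, `|X i - Y i| <= D) ->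
  forall i, `|newton eps x X i - newton eps x Y i| <= kappa * D.
Proof.
have [c0 d0 d1 k0 k1] := signs.
move=> /andP[e0 ee0] xK x0 Xx Yx XYD i.
set v := derive1n 2 V (x i).
have cv : c < `|v| := cc_c cc (x0 i).
have v0 : v != 0 by rewrite -normr_gt0 (lt_trans c_gt0).
have D0 : 0 <= D by apply: le_trans (XYD i); rewrite normr_ge0.
(* When X i = Y i any slope serves; v keeps the bound on q - v trivial. *)
have [q qv qE] : exists2 q, `|q - v| <= kappa * c / 2 &
    derive1 V (X i) - derive1 V (Y i) = q * (X i - Y i).
  have [->|YX] := eqVneq (X i) (Y i).
    by exists v; rewrite ?subrr ?normr0 ?mulr0 // divr_ge0 // mulr_ge0 ?ltW.
  rewrite eq_sym in YX.
  have [q qXY qE] := mean_value (derivable_derive1_potential morseV) YX.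
  exists (derive1n 2 V q) => //; apply: (cc_delta0_V cc (x0 i)).
  exact: between_near (Yx i) (Xx i) qXY.
have fXY : `|force S i X - force S i Y| <= C2 * D.
  by apply: (force_near_dist i xK Yx Xx).
have -> : newton eps x X i - newton eps x Y i =
    ((v - q) * (X i - Y i) - eps * (force S i X - force S i Y)) / v.
  by rewrite [(v - q) * _]mulrBl -qE /newton -/v; field.
rewrite normrM normfV ler_pdivrMr ?(lt_trans c_gt0) //.
apply: le_trans (_ : kappa * c / 2 * D + eps * C2 * D <= _); last first.
  apply: (@le_trans _ _ (kappa * D * c)); last by rewrite ler_wpM2l ?(ltW cv) ?mulr_ge0 ?(ltW k0).
  have := ler_wpM2r D0 (eps_C2 ee0); lra.
apply: le_trans (ler_normB _ _) _; rewrite !normrM (ger0_norm e0) [`|v - q|]distrC.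
apply: lerD; first by apply: ler_pM.
by rewrite -mulrA ler_wpM2l.
Qed.

Lemma newton_fixed eps x X i : derive1 V (x i) = 0 ->
  newton eps x X i = X i <-> derive1 V (X i) + eps * force S i X = 0.
Proof.
move=> x0; have v0 : derive1n 2 V (x i) != 0.
  by rewrite -normr_gt0 (lt_trans c_gt0) // (cc_c cc).
rewrite /newton; split=> [/eqP|->]; last by rewrite mul0r subr0.
by rewrite -subr_eq0 addrAC subrr sub0r oppr_eq0 mulf_eq0 invr_eq0 (negbTE v0) orbF => /eqP.
Qed.

Lemma continuation_exists eps x : 0 <= eps <= eps0 / 2 ->
  (osc r x <= K%:E)%E -> (forall i, derive1 V (x i) = 0) ->
  exists X, is_continuation V S delta0 eps x X.
Proof.
have [c0 d0 d1 k0 k1] := signs.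
move=> /andP[e0 ee] xK x0.
have ee0 : 0 <= eps <= eps0 by rewrite e0 (le_trans ee) //; have := eps0_gt0; lra.
have k01 : 0 <= kappa < 1 by rewrite ltW.
have half X : (forall i, `|X i - x i| <= delta0 / 2) -> forall i, `|X i - x i| < delta0.
  by move=> H i; apply: le_lt_trans (H i) _; lra.
have xx (rho : R) : 0 <= rho -> forall i, `|x i - x i| <= rho.
  by move=> ? i; rewrite subrr normr0.
have [||X D XB YB XYD|X Xx XT] :=
    @contraction_fixed_point R _ x kappa (delta0 / 2) (newton eps x) k01.
- by rewrite divr_ge0 // ltW.
- move=> X XB i.
  have d20 : 0 <= delta0 / 2 by rewrite divr_ge0 // ltW.
  have h1 := newton_dist ee0 xK x0 (half _ XB) (half _ (xx _ d20)) XB i.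
  have h2 : `|newton eps x x i - x i| <= (1 - kappa) * delta0 / 2.
    rewrite /newton x0 add0r addrAC subrr sub0r normrN normrM normfV.
    have cv : c < `|derive1n 2 V (x i)| := cc_c cc (x0 i).
    rewrite ler_pdivrMr ?(lt_trans c_gt0) // normrM (ger0_norm e0).
    apply: (@le_trans _ _ (eps * C1)).
      rewrite ler_wpM2l //; apply: force_bound => // j; apply: (cc_C1 cc).
      by apply: le_trans xK _; rewrite lee_fin; lra.
    apply: le_trans (eps_C1 ee) _; rewrite mulrC ler_wpM2l ?ltW //.
    by rewrite divr_gt0 // mulr_gt0 // subr_gt0.
  apply: le_trans (ler_distD (newton eps x x i) _ _) _.
  by apply: le_trans (lerD h1 h2) _; lra.
- by apply: newton_dist => //; exact: half.
exists X; split.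
  split; first by apply: (le_sup_ball _ Xx); lra.
  by move=> i; apply/(newton_fixed _ _ (x0 i)).
move=> Y [/sup_ball_lt Yx eY]; apply/funext => i; apply/eqP; rewrite -subr_eq0; apply/eqP.
apply: (le_geometric_eq0 (D := 2 * delta0) k01) => n.
elim: n i => [|n ih] i.
  rewrite expr0 mul1r; have := half _ Xx i; have := Yx i; rewrite !ltr_norml ler_norml.
  by move=> /andP[? ?] /andP[? ?]; apply/andP; split; lra.
rewrite -(XT i) -((newton_fixed _ _ (x0 i)).2 (eY i)) exprS -mulrA.
by apply: newton_dist => //; exact: half.
Qed.

(** The force difference between X and Y is split at Z, which agrees with X except
    for Z_i = Y_i.  Passing from X to Z changes one coordinate within delta0 of
    x_i, so C2 bounds the change; passing from Z to Y only lowers the force.  The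
    splitting matters because configurations between X and Y need not have
    oscillation bounded by K + 1. *)
Lemma touching_continuations eps x y X Y i :
  twist S -> (0 < r)%N -> 0 < eps <= eps0 ->
  (osc r x <= K%:E)%E ->
  (forall k, derive1 V (x k) = 0) -> (forall k, derive1 V (y k) = 0) ->
  (forall k, `|X k - x k| < delta0) -> (forall k, `|Y k - y k| < delta0) ->
  equilibrium V S eps X -> equilibrium V S eps Y ->
  (forall k, X k <= Y k) -> x i = y i -> local_max V (x i) -> x = y.
Proof.
have [c0 d0 d1 k0 k1] := signs.
move=> tw r0 /andP[e0 ee0] xK x0 y0 Xx Yy eX eY XY xyi maxi.
suff XYi : X i = Y i.
  have XYE := strong_maximum_principle frS r0 tw e0 eX eY XY XYi.
  apply/funext => k; apply: (crit_sep morseV c_gt0 (cc_c cc) kappa01 delta0_gt0 (cc_delta0_V cc)) => //.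
  have := Xx k; have := Yy k; rewrite XYE !ltr_norml.
  by move=> /andP[? ?] /andP[? ?]; apply/andP; split; lra.
apply/eqP; apply/negP => /negP XYi.
have XYi' : X i < Y i by rewrite lt_neqAle XYi XY.
have D0 : 0 < Y i - X i by rewrite subr_gt0.
have V2x := local_max_concave morseV c_gt0 (cc_c cc) kappa01 delta0_gt0
  (cc_delta0_V cc) (x0 i) maxi.
have [q qXY qE] := mean_value (derivable_derive1_potential morseV) XYi.
have Yx : `|Y i - x i| < delta0 by rewrite xyi.
have V2q := V2x _ (between_near (Xx i) Yx qXY).
pose Z := upd X i (Y i).
have fYZ : force S i Y <= force S i Z.
  by apply: force_le => // [k|]; rewrite /Z updE; [case: eqP => [->|] | rewrite eqxx].
have fZX : `|force S i Z - force S i X| <= C2 * (Y i - X i).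
  apply: (force_near_dist i xK Xx _ (ltW D0)) => k; rewrite /Z updE; case: eqP => [->|_] //.
  - by rewrite gtr0_norm.
  - by rewrite subrr normr0 ltW.
have fYX : eps * (force S i Y - force S i X) <= kappa * c / 2 * (Y i - X i).
  apply: (@le_trans _ _ (eps * C2 * (Y i - X i))); last first.
    by rewrite ler_wpM2r ?(ltW D0) // eps_C2.
  rewrite -mulrA ler_wpM2l ?(ltW e0) //; apply: le_trans fZX.
  by apply: le_trans (ler_norm _); rewrite lerD2r.
have V1 : derive1 V (Y i) - derive1 V (X i) <= - (c - kappa * c / 2) * (Y i - X i).
  by rewrite qE ler_wpM2r ?(ltW D0).
have kc : 0 < (c - kappa * c) * (Y i - X i).
  by rewrite mulr_gt0 // subr_gt0 gtr_pMl.
have := congr2 (fun a b => a - b) (eY i) (eX i).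
rewrite subr0 opprD addrACA -mulrBr; apply/eqP; rewrite lt_eqF //.
by apply: le_lt_trans (lerD V1 fYX) _; rewrite -mulrDl -oppr_gt0 -mulNr; lra.
Qed.

End Continuation.

(** * Non-Birkhoff continuations *)

Theorem theorem5p3 (R : realType) (d : nat) (V : R -> R)
    (S : 'rV[int]_d -> ('rV[int]_d -> R) -> R) (r : nat)
    (w : 'rV[R]_d) (K c C1 C2 kappa delta0 eps0 : R) :
  (0 < d)%N ->
  C2_periodic_morse V ->
  (0 < r)%N -> finite_range r S ->
  shift_invariant S ->
  twist S ->
  irrational_vector w ->
  0 < K ->
  (forall X : 'rV[int]_d -> R,
     birkhoff X -> rotation_vector X w -> (osc r X <= K%:E)%E) ->
  continuation_constants V S r K c C1 C2 kappa delta0 eps0 ->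
  exists eps1 : R, 0 < eps1 <= eps0 /\
    forall eps : R, 0 < eps <= eps1 ->
    forall x : 'rV[int]_d -> R,
      birkhoff x -> rotation_vector x w -> recurrent x w ->
      (forall i, derive1 V (x i) = 0) ->
      (exists i, local_max V (x i)) ->
      exists X : 'rV[int]_d -> R,
        is_continuation V S delta0 eps x X /\ ~ birkhoff X.
Proof.
move=> _ morseV r0 frS siS tw _ _ HK cc.
have eps0p := eps0_gt0 cc.
exists (eps0 / 2); split; first by apply/andP; split; lra.
move=> eps /andP[e0 ee] x Bx rotx [k [l [kl recx]]] x0 [i maxi].
have xK := HK x Bx rotx.
have ee0 : 0 < eps <= eps0 by apply/andP; split=> //; lra.
have eB : 0 <= eps <= eps0 / 2 by rewrite ltW.
have [X XC] := continuation_exists morseV frS cc eB xK x0.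
exists X; split=> // BX; case: XC => [[/sup_ball_lt Xx eX] _].
have /andP[d0 _] := cc_delta0 cc.
have d20 : 0 < 2 * delta0 by rewrite mulr_gt0.
have [N _ /(_ N (leqnn N)) /= xN] : \forall n \near \oo, `|x i - tau (k n) (l n) x i| < 2 * delta0.
  by move/cvgrPdist_lt : (recx i); apply.
set y := tau (k N) (l N) x; set Y := tau (k N) (l N) X.
have y0 j : derive1 V (y j) = 0 by rewrite /y /tau derive1_potential_addz.
have xyi : x i = y i.
  apply: (crit_sep morseV (cc_c_gt0 cc) (cc_c cc) (cc_kappa cc) d0 (cc_delta0_V cc)) => //.
  by rewrite distrC.
have yK : (osc r y <= K%:E)%E by rewrite osc_tau.
have Yy j : `|Y j - y j| < delta0.
  by rewrite /Y /y /tau opprD addrACA subrr addr0.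
have eY : equilibrium V S eps Y.
  move=> j; rewrite (force_tau frS) // /Y /tau derive1_potential_addz //; exact: eX.
have maxyi : local_max V (y i) by rewrite -xyi.
have XinO : exists k (l : int), X = tau k l X.
  by exists 0, 0; apply/funext => j; rewrite /tau !addr0.
have YinO : exists k (l : int), Y = tau k l X by exists (k N), (l N).
suff xy : x = y by apply/negP: (kl N); rewrite negbK; apply/eqP/(tau_fixed_rotation rotx).
case: (BX X Y XinO YinO) => [[_ XY]|XY|[_ YX]].
- exact: (touching_continuations morseV frS cc tw r0 ee0 xK x0 y0 Xx Yy eX eY XY xyi maxi).
- have {}XY j : X j <= Y j by rewrite -XY.
  exact: (touching_continuations morseV frS cc tw r0 ee0 xK x0 y0 Xx Yy eX eY XY xyi maxi).
- apply/esym.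
  exact: (touching_continuations morseV frS cc tw r0 ee0 yK y0 x0 Yy Xx eY eX YX (esym xyi) maxyi).
Qed.
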